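(* Let $k$ and $m\geq 2$ be positive integers, let $n_1,\dots,n_m$ be positive integers and $n=n_1+\cdots+n_m$. Let $\sigma\in\mathrm{SIM}(X)$ have disjoint path and cycle decomposition \[\sigma=\sigma_{11}\cdots\sigma_{1n_1}\,\sigma_{21}\cdots\sigma_{2n_2}\cdots\sigma_{m1}\cdots\sigma_{mn_m}\] consisting only of paths (no cycles), where every path $\sigma_{ij}$ has length $\ell(\sigma_{ij})=m-(i-1)$ (so the $\sigma_{1j}$ have length $m$ and the $\sigma_{mj}$ have length $1$). Then \[ r_k(\sigma)=\sum_{\lambda_1,\dots,\lambda_{m}}\frac{n_1!\,n_2!\cdots n_m!}{\prod_{i=1}^{m}\prod_{a\in\lambda_i}\mathrm{freq}(a,\lambda_i)!}, \] where the sum is over all tuples of integer partitions $\lambda_1,\dots,\lambda_{m}$ such that $\lambda_j\vdash \sum_{i=1}^{j}n_i-k\sum_{i=1}^{j-1}\ell(\lambda_i)$ for $1\le j\le m$ (so $\lambda_1\vdash n_1$, $\lambda_2\vdash n_1+n_2-k\ell(\lambda_1)$, etc.), $\max\lambda_i\leq k$ for all $1\le i\le m$, and $\ell(\lambda_i)\leq (n_{i+1}+\sum\lambda_i)/k$ for all $1\le i\le m-1$. Some of the $\lambda_i$ may be the (empty) partition of zero.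
   Context: For a finite set $X$, $\mathrm{SIM}(X)$ is the symmetric inverse monoid: the set of all partial one-to-one maps from $X$ to itself, under composition. For distinct $a_1,\dots,a_\ell$, the path $[a_1a_2\cdots a_\ell]$ is the partial map sending $a_i\mapsto a_{i+1}$ for $i<\ell$ and undefined at $a_\ell$ (so $[a]$ is the nowhere-defined map on $\{a\}$); the cycle $(a_1\cdots a_\ell)$ sends $a_i\mapsto a_{i+1}$ for $i<\ell$ and $a_\ell\mapsto a_1$. Its length is $\ell$ and $a_1,\dots,a_\ell$ are its digits. Paths/cycles are disjoint if their digit sets are disjoint, and a product of disjoint paths/cycles is the partial map on the union of their digits agreeing with each one on its digits. Every element of $\mathrm{SIM}(X)$ is uniquely a product of disjoint paths and cycles whose digit sets partition $X$ (its disjoint path and cycle decomposition, length-one paths and cycles included). For a positive integer $k$, a $k$th root of $\sigma\in\mathrm{SIM}(X)$ is an $\alpha\in\mathrm{SIM}(X)$ with $\alpha^k=\sigma$, and $r_k(\sigma)$ denotes the number of $k$th roots of $\sigma$. For an integer partition $\lambda: a_1+\cdots+a_t=N$ of $N$ into positive parts we write $\lambda\vdash N$, $\ell(\lambda)=t$, $\max\lambda=\max_i a_i$, $\sum\lambda=N$, and $\mathrm{freq}(a,\lambda)$ is the number of indices $i$ with $a_i=a$; $\prod_{a\in\lambda}$ ranges over the distinct values occurring among the parts. The partition of zero is the empty partition, with length $0$. *)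

(* Defs.v *)
From HB Require Import structures.
From mathcomp Require Import all_boot all_order all_algebra.
From mathcomp Require Import classical_sets fsbigop.

Set Implicit Arguments.
Unset Strict Implicit.
Unset Printing Implicit Defensive.

Import Order.TTheory GRing.Theory Num.Theory.

Local Open Scope ring_scope.

Section SymmetricInverseMonoid.

Variable X : finType.

(* A partial map is a function to [option X], [None] meaning "undefined". *)
Definition partial_inj (f : {ffun X -> option X}) : bool :=
  [forall x, forall y, (f x != None) && (f x == f y) ==> (x == y)].

Record SIM := MkSIM {
  sim_fun :> {ffun X -> option X};
  sim_inj : partial_inj sim_fun
}.

HB.instance Definition _ := [isSub for sim_fun].
HB.instance Definition _ := [Finite of SIM by <:].

Lemma partial_injP (f : {ffun X -> option X}) :
  reflect (forall x y z, f x = Some z -> f y = Some z -> x = y)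
          (partial_inj f).
Proof.
apply: (iffP forallP) => [H x y z fx fy | H x].
  by have /forallP/(_ y) := H x; rewrite fx fy eqxx /= => /eqP.
apply/forallP => y; apply/implyP => /andP[].
case fx: (f x) => [z|//] _ /eqP/esym fy.
by apply/eqP; apply: H fx fy.
Qed.

Lemma sim_one_inj : partial_inj [ffun x => Some x].
Proof. by apply/partial_injP => x y z; rewrite !ffunE => -[->] [->]. Qed.

Definition sim_one : SIM := MkSIM sim_one_inj.

Lemma sim_mul_inj (f g : SIM) : partial_inj [ffun x => obind g (f x)].
Proof.
apply/partial_injP => x y z; rewrite !ffunE.
case fx: (f x) => [u|//]; case fy: (f y) => [v|//] /= gu gv.
have uv := partial_injP _ (sim_inj g) _ _ _ gu gv.
by apply: (partial_injP _ (sim_inj f) _ _ _ fx); rewrite uv.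
Qed.

(* Maps are composed from left to right, as in [perm]. *)
Definition sim_mul (f g : SIM) : SIM := MkSIM (sim_mul_inj f g).

Lemma sim_mulA : associative sim_mul.
Proof.
move=> f g h; apply: val_inj; apply/ffunP => x; rewrite !ffunE /=.
by case: (f x) => //= y; rewrite ffunE.
Qed.

Lemma sim_mul1 : left_id sim_one sim_mul.
Proof. by move=> f; apply: val_inj; apply/ffunP => x; rewrite !ffunE. Qed.

Lemma sim_mulr1 : right_id sim_one sim_mul.
Proof.
move=> f; apply: val_inj; apply/ffunP => x; rewrite !ffunE /=.
by case: (f x) => //= y; rewrite ffunE.
Qed.

HB.instance Definition _ := isMonoid.Build SIM sim_mulA sim_mul1 sim_mulr1.

Definition num_roots (k : nat) (sigma : SIM) : nat :=
  #|[pred alpha : SIM | (alpha ^+ k)%g == sigma]|.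

Inductive component :=
  | Path of seq X
  | Cycle of seq X.

Definition digits (c : component) : seq X :=
  match c with Path s => s | Cycle s => s end.

(* [onth s i] is [None] past the end of [s], so the last digit of a path, as
   well as any point that is not one of its digits, is sent to [None]. *)
Definition component_fun (c : component) (x : X) : option X :=
  match c with
  | Path s => onth s (index x s).+1
  | Cycle s => if x \in s then Some (next s x) else None
  end.

(* The [perm_eq] clause says that the digits within each component are
   distinct, that the components are disjoint, and that their digit sets
   cover [X]. *)
Definition is_decomposition (sigma : SIM) (cs : seq component) : Prop :=
  [/\ all (fun c => digits c != [::]) cs,
      perm_eq (flatten (map digits cs)) (enum X)
    & all (fun c => all (fun x => sigma x == component_fun c x) (digits c)) cs].

End SymmetricInverseMonoid.

Arguments Path {X} s.
Arguments Cycle {X} s.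

(* Integer partitions (of any number), listed in weakly decreasing order. *)
Record intpart := MkIntpart {
  parts :> seq nat;
  parts_spec : sorted geq parts && all (leq 1) parts
}.

HB.instance Definition _ := [isSub for parts].
HB.instance Definition _ := [Countable of intpart by <:].

Definition freq (a : nat) (l : intpart) : nat := count_mem a l.

(* Index [i : 'I_m] stands for the 1-based index [i + 1]. The equation is in
   [int] and the quotient in [rat], so neither is truncated. *)
Definition admissible (k m : nat) (n : 'I_m -> nat)
    (lam : {ffun 'I_m -> intpart}) : Prop :=
  [/\ forall j : 'I_m,
        (sumn (lam j))%:Z =
        (\sum_(i < m | (i <= j)%N) n i)%N%:Z
        - k%:Z * (\sum_(i < m | (i < j)%N) size (lam i))%N%:Z,
      forall i : 'I_m, (\max_(a <- lam i) a <= k)%N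
    & forall i i' : 'I_m, i' = i.+1 :> nat ->
        (size (lam i))%:R <= (n i' + sumn (lam i))%N%:R / k%:R :> rat].

Definition weight (m : nat) (n : 'I_m -> nat)
    (lam : {ffun 'I_m -> intpart}) : rat :=
  (\prod_(i < m) (n i)`!)%N%:R /
  (\prod_(i < m) \prod_(a <- undup (lam i)) (freq a (lam i))`!)%N%:R.

(* Main.v *)
Require Import Defs.
From mathcomp Require Import all_boot all_order all_algebra.
From mathcomp Require Import classical_sets fsbigop.
From mathcomp Require Import perm zify.

(** A nilpotent partial injection is determined up to conjugation by the
    multiset [l] of its path lengths, and exactly [\prod_a freq(a, l)!]
    permutations of [X] conjugate it to a given one of the same type, since
    such a permutation amounts to a length-preserving bijection between the
    paths.  If [f ^+ k] is conjugate to [sigma], the permutations conjugating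
    [f ^+ k] to [sigma] are those conjugating [f] to one of the roots of
    [sigma]; hence the number of roots of the same type as [f] is the quotient
    of the two products of factorials, and it remains to enumerate the types
    of the roots.  The type of [f] is encoded by the sizes of the domains of
    its powers, the domain of [f ^+ j] having [\sum_(a <- l) (a - j)] elements,
    so [f] has the type of a root if and only if this quantity at [k * j] is
    the one of [sigma] at [j], for all [j].  Writing each path length as
    [(m - i) * k + a] with [0 < a <= k], and collecting the values of [a] in the
    partition [lambda_i], turns these conditions into the admissibility
    equations. *)

Set Implicit Arguments.
Unset Strict Implicit.
Unset Printing Implicit Defensive.

Import Order.TTheory GRing.Theory Num.Theory.

(** * Products of factorials of multiplicities *)

(** The product of the factorials of the multiplicities, in recursive form: the copies of [a]
    contribute the factors [c], [c - 1], ..., 1, one at each occurrence. *)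
Fixpoint mult_fact (l : seq nat) : nat :=
  if l is a :: l' then count_mem a l * mult_fact l' else 1.

Lemma mult_fact_prod (r l : seq nat) :
  uniq r -> {subset l <= r} -> mult_fact l = \prod_(a <- r) (count_mem a l)`!.
Proof.
move=> Ur; elim: l => [|a l IHl] sub_lr.
  by rewrite /= big1.
have ra : a \in r by apply: sub_lr; rewrite mem_head.
rewrite /= IHl => [|b lb]; last by apply: sub_lr; rewrite inE lb orbT.
rewrite !(bigD1_seq a ra Ur) /= eqxx factS mulnA; congr (_ * _).
by apply: eq_bigr => b; rewrite eq_sym => /negPf ->.
Qed.

Lemma mult_fact_undup (l : seq nat) :
  mult_fact l = \prod_(a <- undup l) (count_mem a l)`!.
Proof.
by apply: mult_fact_prod => [|a]; rewrite ?undup_uniq // mem_undup.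
Qed.

Lemma mult_fact_gt0 (l : seq nat) : 0 < mult_fact l.
Proof. by rewrite mult_fact_undup prodn_gt0 // => a; rewrite fact_gt0. Qed.

Lemma perm_mult_fact (l1 l2 : seq nat) :
  perm_eq l1 l2 -> mult_fact l1 = mult_fact l2.
Proof.
move=> Pl; rewrite [in LHS]mult_fact_undup.
rewrite (@mult_fact_prod (undup l1) l2) ?undup_uniq //.
  by apply: eq_bigr => a _; rewrite (seq.permP Pl).
by move=> a; rewrite mem_undup (perm_mem Pl).
Qed.

(** The first entry of such a permutation is any of the elements labelled by the head of [l];
    removing it leaves the same problem for the tail, which is the recursion of [mult_fact]. *)
Lemma count_permutations_labelled (T : eqType) (v : T -> nat) (s : seq T)
    (l : seq nat) :
  uniq s -> perm_eq (map v s) l ->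
  count (fun t => map v t == l) (permutations s) = mult_fact l.
Proof.
elim: l s => [|a l IHl] s Us Psl.
  have: size (map v s) = 0 by rewrite (perm_size Psl).
  by case: s Us Psl.
have s_gt0 : 0 < size s by rewrite -(size_map v) (perm_size Psl).
rewrite (seq.permP (permutationsE s_gt0)) undup_id // count_flatten -map_comp.
rewrite sumnE big_map big_seq.
rewrite (eq_bigr (fun x => (v x == a) * mult_fact l)); last first.
  move=> x sx /=; rewrite count_map.
  have [vx|vx] := eqVneq (v x) a; last first.
    by apply/eqP; rewrite mul0n eqn0Ngt -has_count; apply/hasPn => t _ /=;
       rewrite eqseq_cons (negPf vx).
  rewrite mul1n -(IHl (rem x s)) ?rem_uniq //.
    by apply: eq_count => t /=; rewrite eqseq_cons vx eqxx.
  rewrite -(perm_cons a) -(seq.permPr Psl) perm_sym -vx.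
  by rewrite -[v x :: map v _]/(map v (x :: rem x s)) perm_map ?perm_to_rem.
rewrite -big_seq -big_distrl /= -[RHS]/(count_mem a (a :: l) * _).
rewrite -(seq.permP Psl) count_map -sum1_count; congr (_ * _).
rewrite [RHS]big_mkcond /=.
by apply: eq_bigr => x _ /=; case: eqP.
Qed.

(** * Truncated sums determining a multiset *)

Definition excess (l : seq nat) (j : nat) : nat := \sum_(a <- l) (a - j).

Lemma excessS (l : seq nat) (j : nat) :
  excess l j = excess l j.+1 + count (leq j.+1) l.
Proof.
rewrite /excess -sum1_count [X in _ = _ + X]big_mkcond -big_split /=.
by apply: eq_bigr => a _; case: ifP; lia.
Qed.

Lemma count_gtS (l : seq nat) (j : nat) :
  count (leq j.+1) l = count (leq j.+2) l + count_mem j.+1 l.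
Proof. by elim: l => //= a l ->; lia. Qed.

(** First differences of [excess] count the entries greater than [j], and second differences the
    entries equal to [j.+1]. Zero entries are invisible to [excess], whence the positivity
    hypotheses. *)
Lemma excess_inj (l1 l2 : seq nat) :
  all (leq 1) l1 -> all (leq 1) l2 -> excess l1 =1 excess l2 -> perm_eq l1 l2.
Proof.
move=> l1_gt0 l2_gt0 E; apply/allP => -[|a] _; apply/eqP => /=.
  by rewrite !(count_memPn _) //; apply/negP => ?;
     [have := allP l2_gt0 0 | have := allP l1_gt0 0]; auto.
have Ea := E a; have := E a.+1; have := E a.+2.
have := excessS l1 a; have := excessS l2 a.
have := excessS l1 a.+1; have := excessS l2 a.+1.
have := count_gtS l1 a; have := count_gtS l2 a.
move: (excess l1 a.+1) (excess l1 a.+2) (excess l2 a.+1) (excess l2 a.+2) Ea.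
move: (excess l1 a) (excess l2 a) (count (leq a.+1) l1) (count (leq a.+1) l2).
move: (count (leq a.+2) l1) (count (leq a.+2) l2).
move: (count_mem a.+1 l1) (count_mem a.+1 l2); lia.
Qed.

Lemma perm_excess (l1 l2 : seq nat) :
  perm_eq l1 l2 -> excess l1 =1 excess l2.
Proof. by move=> Pl j; apply: perm_big. Qed.

Lemma sumn_excess (l : seq nat) : sumn l = excess l 0.
Proof. by rewrite sumnE; apply: eq_bigr => a _; rewrite subn0. Qed.

Lemma excess_eq0 (l : seq nat) (j : nat) :
  (excess l j == 0) = all (fun a => a <= j) l.
Proof.
rewrite /excess sum_nat_seq_eq0; apply: eq_all => a /=.
by rewrite subn_eq0.
Qed.

(** * Path decompositions *)

Lemma uniq_flatten_mem (T : eqType) (ss : seq (seq T)) (s : seq T) :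
  uniq (flatten ss) -> s \in ss -> uniq s.
Proof.
elim: ss => //= t ss IH; rewrite cat_uniq => /and3P[Ut _ Uss].
by rewrite inE => /predU1P[-> //|]; apply: IH.
Qed.

Lemma uniq_flatten_inj (T : eqType) (ss : seq (seq T)) (s t : seq T) (x : T) :
  uniq (flatten ss) -> s \in ss -> t \in ss -> x \in s -> x \in t -> s = t.
Proof.
elim: ss => //= u ss IH; rewrite cat_uniq => /and3P[_ /hasPn dis Uss].
have dis' v : v \in ss -> x \in v -> x \in u -> False.
  move=> ssv vx ux.
  have/dis/negP : x \in flatten ss by apply/flattenP; exists v.
  exact.
rewrite !inE => /predU1P[->|ss_s] /predU1P[->|ss_t] // xs xt.
- by case: (dis' t).
- by case: (dis' s).
- exact: IH.
Qed.

Lemma flatten_uniq (T : eqType) (ss : seq (seq T)) :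
  all (fun s => s != [::]) ss -> uniq (flatten ss) -> uniq ss.
Proof.
elim: ss => //= s ss IH /andP[s_n0 ss_n0].
rewrite cat_uniq => /and3P[_ /hasPn dis Uss]; rewrite IH // andbT.
apply/negP => ss_s; case: s s_n0 ss_s dis => // x s _ ss_s.
have: x \in flatten ss by apply/flattenP; exists (x :: s); rewrite ?mem_head.
by move=> /[swap]/[apply] /=; rewrite mem_head.
Qed.

Lemma onth_some (T : Type) (x0 : T) (s : seq T) (i : nat) :
  i < size s -> onth s i = Some (nth x0 s i).
Proof.
by rewrite -onthTE; case E: onth => [x|] // _; rewrite (onth_nth _ _ _ _ E).
Qed.

Section PathDecompositions.

Variable X : finType.
Implicit Types (f g : SIM X) (ss : seq (seq X)) (s : seq X) (x y z : X).

Lemma sim_ext f g : (forall x, f x = g x) -> f = g.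
Proof. by move=> fg; apply: val_inj; apply/ffunP. Qed.

Lemma sim_fun_inj f x y z : f x = Some z -> f y = Some z -> x = y.
Proof. by move: x y z; apply/partial_injP/sim_inj. Qed.

Lemma sim_mulE f g x : (f * g)%g x = obind g (f x).
Proof. by rewrite ffunE. Qed.

Lemma sim_expS f j x : (f ^+ j.+1)%g x = obind f ((f ^+ j)%g x).
Proof. by rewrite expgSr sim_mulE. Qed.

Lemma sim_exp0 f x : (f ^+ 0)%g x = Some x.
Proof. by rewrite ffunE. Qed.

Definition path_rep f ss : bool :=
  [&& all (fun s => s != [::]) ss, perm_eq (flatten ss) (enum X)
    & all (fun s => all (fun x => f x == onth s (index x s).+1) s) ss].

Lemma path_repP f ss :
  is_decomposition f (map Path ss) -> path_rep f ss.
Proof.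
case=> n0 P E; apply/and3P; split.
- by rewrite all_map in n0.
- by rewrite -map_comp map_id_in in P.
- by rewrite all_map in E.
Qed.

Section Rep.

Variables (f : SIM X) (ss : seq (seq X)).
Hypothesis rep : path_rep f ss.

Lemma rep_flatten_uniq : uniq (flatten ss).
Proof. by case/and3P: rep => _ P _; rewrite (perm_uniq P) enum_uniq. Qed.

Lemma rep_uniq : uniq ss.
Proof.
by case/and3P: (rep) => n0 _ _; apply: flatten_uniq rep_flatten_uniq.
Qed.

Lemma rep_mem_uniq s : s \in ss -> uniq s.
Proof. exact: uniq_flatten_mem rep_flatten_uniq. Qed.

Lemma rep_cover x : exists2 s, s \in ss & x \in s.
Proof.
by case/and3P: rep => _ P _; apply/flattenP; rewrite (perm_mem P) mem_enum.
Qed.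

Lemma rep_step s x : s \in ss -> x \in s -> f x = onth s (index x s).+1.
Proof.
by case/and3P: rep => _ _ /allP E ss_s sx; apply/eqP/(allP (E _ ss_s)).
Qed.

Lemma rep_onth s i x : s \in ss -> onth s i = Some x -> f x = onth s i.+1.
Proof.
move=> ss_s si; have sx : x \in s by apply/onthP; exists i.
have i_s : i < size s by rewrite -onthTE si.
rewrite (rep_step ss_s sx) -(onth_nth x _ _ _ si) index_uniq //.
exact: rep_mem_uniq.
Qed.

Lemma rep_exp s i x j :
  s \in ss -> onth s i = Some x -> (f ^+ j)%g x = onth s (i + j).
Proof.
move=> ss_s si; elim: j => [|j IHj]; first by rewrite sim_exp0 addn0.
rewrite sim_expS IHj addnS; case E: onth => [y|].
  exact: rep_onth E.
by rewrite [RHS]onth_default // ltnW // ltnS -onthNE E.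
Qed.

(** On a path [s], the [j]-th power is defined exactly at the positions [i] with [i + j < size s],
    that is, at the first [size s - j] of them. *)
Lemma rep_domain j :
  #|[pred x | (f ^+ j)%g x != None]| = excess (map size ss) j.
Proof.
have -> : #|[pred x | (f ^+ j)%g x != None]| =
          count (fun x => (f ^+ j)%g x != None) (flatten ss).
  case/and3P: rep => _ P _; rewrite (seq.permP P).
  by rewrite enumT cardE /enum_mem size_filter; apply: eq_count.
rewrite count_flatten sumnE big_map /excess big_map big_seq [RHS]big_seq.
apply: eq_bigr => s ss_s; have Us := rep_mem_uniq ss_s.
case: s ss_s Us => [//|x0 s0]; set s := x0 :: s0 => ss_s Us.
(* Writing [s] as the image of its positions turns the count of points into a count of indices. *)
rewrite -[s in count _ s](mkseq_nth x0) count_map.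
rewrite (eq_in_count (a2 := fun i => i < size s - j)); last first.
  move=> i; rewrite mem_iota /= add0n => i_s.
  have si : onth s i = Some (nth x0 s i).
    exact: onth_some.
  rewrite (rep_exp _ ss_s si) ltn_subRL (addnC j) -[_ < _](onthTE s).
  by case: onth.
have : size s - j <= size s by apply: leq_subr.
move: (size s) (size s - j) => a b ba.
rewrite -(subnKC ba) iotaD count_cat.
rewrite (eq_in_count (a2 := predT)) => [|i]; last first.
  by rewrite mem_iota /= add0n => ->.
rewrite count_predT size_iota (eq_in_count (a2 := pred0)) => [|i].
  by rewrite count_pred0 addn0.
by rewrite mem_iota /= add0n => /andP[bi _]; rewrite ltnNge bi.
Qed.

(** A preimage of [x0] would put [x0] at a positive position of some path; by disjointness this path
    is [x0 :: s], where [x0] has position 0. *)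
Lemma rep_head s x0 x : x0 :: s \in ss -> (f x == Some x0) = false.
Proof.
move=> ss_s; apply/eqP => fx; have [t ss_t tx] := rep_cover x.
have := rep_step ss_t tx; rewrite fx => /esym tx0.
have x0t : x0 \in t by apply/onthP; exists (index x t).+1.
have E : x0 :: s = t.
  by apply: (uniq_flatten_inj rep_flatten_uniq ss_s ss_t) x0t; rewrite mem_head.
suff : 0 = (index x t).+1 by [].
by apply: (onth_inj _ _ _ (rep_mem_uniq ss_t)); rewrite ?tx0 -E ?minn0.
Qed.

End Rep.

Lemma path_rep_inj f g ss : path_rep f ss -> path_rep g ss -> f = g.
Proof.
move=> rf rg; apply: sim_ext => x; have [s ss_s sx] := rep_cover rf x.
by rewrite (rep_step rf ss_s sx) (rep_step rg ss_s sx).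
Qed.

Lemma path_rep_perm f ss ss' :
  perm_eq ss ss' -> path_rep f ss -> path_rep f ss'.
Proof.
move=> P; rewrite /path_rep !(perm_all _ P) => /and3P[-> Q ->].
by rewrite -(permPl (perm_flatten P)) Q.
Qed.

Lemma path_rep_sub f ss ss' :
  path_rep f ss -> path_rep f ss' -> {subset ss <= ss'}.
Proof.
move=> r r' [|x0 s] ss_s; first by case/and3P: r => /allP/(_ _ ss_s).
have [t ss_t tx] := rep_cover r' x0.
suff -> : x0 :: s = t by [].
(* If [x0] heads [t], both paths list the orbit of [x0] under [f]. At a positive position of [t] it
   would have a preimage, against [rep_head]. *)
have [[|i] ti] := onthP tx.
  apply: eq_from_onth => j.
  have si : onth (x0 :: s) 0 = Some x0 by [].
  by rewrite -[j]add0n -(rep_exp r j ss_s si) -(rep_exp r' j ss_t ti).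
have [y ty] : exists y, onth t i = Some y.
  have: i < size t by apply: ltnW; rewrite -onthTE ti.
  by rewrite -onthTE; case: onth => // y; exists y.
by have := rep_head r y ss_s; rewrite (rep_onth r' ss_t ty) ti eqxx.
Qed.

Lemma path_rep_unique f ss ss' :
  path_rep f ss -> path_rep f ss' = perm_eq ss' ss.
Proof.
move=> r; apply/idP/idP => [r'|P]; last first.
  by apply: path_rep_perm r; rewrite perm_sym.
apply: uniq_perm (rep_uniq r') (rep_uniq r) _ => s.
by apply/idP/idP; [apply: (path_rep_sub r' r) | apply: (path_rep_sub r r')].
Qed.

Lemma path_rep_exists ss :
  all (fun t => t != [::]) ss -> perm_eq (flatten ss) (enum X) ->
  exists f, path_rep f ss.
Proof.
move=> ss_n0 P; have Uss : uniq (flatten ss) by rewrite (perm_uniq P) enum_uniq.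
(* [B x] is the block containing [x]; the default is never reached, since the blocks cover [X]. *)
pose B x := nth [::] ss (find (fun t => x \in t) ss).
have ssB x : B x \in ss /\ x \in B x.
  have hasx : has (fun t => x \in t) ss.
    have /flattenP[t ss_t tx] : x \in flatten ss.
      by rewrite (perm_mem P) mem_enum.
    by apply/hasP; exists t.
  by split; [rewrite mem_nth -?has_find | apply: (nth_find [::] hasx)].
pose F := [ffun x => onth (B x) (index x (B x)).+1].
have Finj : partial_inj F.
  apply/partial_injP => x y z; rewrite !ffunE => Fx Fy.
  have [[Bx xB] [By yB]] := (ssB x, ssB y).
  have BE : B x = B y.
    by apply: (uniq_flatten_inj Uss Bx By (x := z)); apply/onthP;
       eexists; eassumption.
  rewrite BE in xB Fx; rewrite -(nth_index x xB) -[RHS](nth_index x yB).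
  congr nth.
  have szy : (index y (B y)).+1 < size (B y) by rewrite -onthTE Fy.
  suff [] : (index x (B y)).+1 = (index y (B y)).+1 by [].
  apply: (onth_inj (B y)); first exact: uniq_flatten_mem Uss By.
    by rewrite gtn_min szy.
  by rewrite Fx.
exists (MkSIM Finj); rewrite /path_rep ss_n0 P.
apply/allP => t ss_t; apply/allP => x tx; rewrite ffunE; apply/eqP.
have [Bx xB] := ssB x.
by rewrite (uniq_flatten_inj Uss Bx ss_t xB tx).
Qed.

End PathDecompositions.

(** * Conjugation by permutations *)

Section Conjugation.

Variable X : finType.
Implicit Types (f g : SIM X) (ss : seq (seq X)) (s : {perm X}) (x y z : X).

Lemma sim_conj_inj s f : partial_inj [ffun x => omap s (f (s^-1 x)%g)].
Proof.
apply/partial_injP => x y z; rewrite !ffunE.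
case fx: (f _) => [u|//] [<-]; case fy: (f _) => [v|//] [/perm_inj vu].
by apply: (@perm_inj _ s^-1%g); apply: sim_fun_inj fx _; rewrite fy vu.
Qed.

(** With composition from left to right, this is the product of the inverse of [s], [f] and [s]. *)
Definition sim_conj s f : SIM X := MkSIM (sim_conj_inj s f).

Lemma sim_conjE s f x : sim_conj s f (s x) = omap s (f x).
Proof. by rewrite ffunE permK. Qed.

Lemma sim_conjX s f j : sim_conj s (f ^+ j)%g = (sim_conj s f ^+ j)%g.
Proof.
apply: sim_ext => x; rewrite -(permKV s x) sim_conjE.
move: (s^-1 x)%g => {}x; elim: j => [|j IHj]; first by rewrite !sim_exp0.
rewrite !sim_expS -IHj; case: ((f ^+ j)%g x) => //= y; exact/esym/sim_conjE.
Qed.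

Lemma path_rep_conj s f ss :
  path_rep f ss -> path_rep (sim_conj s f) (map (map s) ss).
Proof.
move=> r; case/and3P: (r) => n0 P _; apply/and3P; split.
- by rewrite all_map; apply: sub_all n0; case.
- rewrite -map_flatten; apply: uniq_perm; rewrite ?enum_uniq //.
    by rewrite map_inj_uniq ?(rep_flatten_uniq r) //; apply: perm_inj.
  move=> x; rewrite mem_enum; apply/mapP.
  exists (s^-1 x)%g; last by rewrite permKV.
  by rewrite (perm_mem P) mem_enum.
apply/allP => _ /mapP[t ss_t ->]; apply/allP => _ /mapP[x tx ->]; apply/eqP.
rewrite [LHS]sim_conjE (rep_step r ss_t tx) onth_map index_map //.
exact: perm_inj.
Qed.

Lemma perm_of_paths ss ss' :
  perm_eq (flatten ss) (enum X) -> perm_eq (flatten ss') (enum X) ->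
  map size ss' = map size ss -> exists s : {perm X}, map (map s) ss = ss'.
Proof.
move=> P P' sz; set e := flatten ss; set e' := flatten ss'.
have Ue : uniq e by rewrite (perm_uniq P) enum_uniq.
have Ue' : uniq e' by rewrite (perm_uniq P') enum_uniq.
have se : size e' = size e by rewrite (perm_size P') (perm_size P).
have xe x : x \in e by rewrite (perm_mem P) mem_enum.
(* Both flattenings list [X] without repetition, so matching them position by position is a
   permutation. Since the shapes agree, it carries paths to paths. *)
pose h x := nth x e' (index x e).
have h_inj : injective h.
  move=> x y; rewrite /h (set_nth_default y) ?se ?index_mem // => /eqP.
  rewrite nth_uniq ?se ?index_mem // => /eqP E.
  by rewrite -(nth_index x (xe x)) E nth_index.
exists (perm h_inj); rewrite -[LHS]flattenK -[RHS]flattenK; congr reshape.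
  rewrite /shape -map_comp sz; apply: eq_map => t /=; exact: size_map.
rewrite -map_flatten -/e -/e'; apply: eq_from_onth => i; rewrite onth_map.
case E: (onth e i) => [x|] /=.
  have ie : i < size e by rewrite -onthTE E.
  rewrite permE (onth_some x) ?se //; congr (Some _).
  by rewrite /h -{2}(onth_nth x _ _ _ E) index_uniq.
by rewrite onth_default // se -onthNE E.
Qed.

(** The map sending [s] to [map (map s) ss] is a bijection from these permutations onto the
    reorderings of [ss'] whose lengths are, in order, those of [ss]. *)
Lemma card_sim_conj f g ss ss' :
  path_rep f ss -> path_rep g ss' -> perm_eq (map size ss) (map size ss') ->
  #|[pred s | sim_conj s f == g]| = mult_fact (map size ss).
Proof.
move=> rf rg sz.
rewrite -(@count_permutations_labelled _ size ss') ?(rep_uniq rg) 1?perm_sym //.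
rewrite -size_filter cardE -(size_map (fun s : {perm X} => map (map s) ss)).
have repE (s : {perm X}) : (sim_conj s f == g) = perm_eq (map (map s) ss) ss'.
  rewrite -(path_rep_unique _ rg); apply/eqP/idP => [<-|].
    exact: path_rep_conj.
  by apply: path_rep_inj; apply: path_rep_conj.
have szE (s : {perm X}) : map size (map (map s) ss) = map size ss.
  by rewrite -map_comp; apply: eq_map => t /=; rewrite size_map.
apply/perm_size/uniq_perm.
- rewrite map_inj_uniq ?enum_uniq // => s1 s2 E; apply/permP => x.
  have /eq_in_map -> // : map s1 (flatten ss) = map s2 (flatten ss).
    by rewrite !map_flatten E.
  by case/and3P: rf => _ /perm_mem -> _; rewrite mem_enum.
- by rewrite filter_uniq ?permutations_uniq.
move=> t; rewrite mem_filter mem_permutations; apply/mapP/andP.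
  by case=> s; rewrite mem_enum inE repE => P ->; rewrite P szE.
case=> /eqP sz_t Pt; have [||//|s ts] := @perm_of_paths ss t.
- by case/and3P: rf.
- by rewrite (permPl (perm_flatten Pt)); case/and3P: rg.
by exists s; rewrite // mem_enum inE repE ts.
Qed.

Lemma sim_conj_type s f g ss ss' :
  path_rep f ss -> path_rep g ss' -> sim_conj s f = g ->
  perm_eq (map size ss) (map size ss').
Proof.
move=> rf rg fg; have := path_rep_conj s rf; rewrite fg (path_rep_unique _ rg).
move=> /(perm_map size); rewrite -map_comp.
by rewrite (eq_map (_ : size \o map s =1 size)) // => t; rewrite /= size_map.
Qed.

End Conjugation.

(** * Path decomposition of nilpotent elements *)

Section Nilpotent.

Variable X : finType.
Implicit Types (f : SIM X) (x y z : X).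

Lemma sim_exp_none f x i j :
  i <= j -> (f ^+ i)%g x = None -> (f ^+ j)%g x = None.
Proof.
move=> /subnKC <-; move: (j - i) => d fi.
elim: d => [|d IHd]; rewrite ?addn0 //.
by rewrite addnS sim_expS IHd.
Qed.

(* Equal to [M], not to the path length, if [f ^+ M] is defined at [x]. *)
Definition sim_len (M : nat) f x : nat :=
  find (fun j => (f ^+ j)%g x == None) (iota 0 M).

Definition sim_path (M : nat) f x : seq X :=
  mkseq (fun j => odflt x ((f ^+ j)%g x)) (sim_len M f x).

Definition sim_heads f : seq X := enum [pred x | [forall y, f y != Some x]].

Definition sim_paths (M : nat) f : seq (seq X) :=
  map (sim_path M f) (sim_heads f).

Lemma sim_headsP f x : reflect (forall y, f y <> Some x) (x \in sim_heads f).
Proof.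
rewrite mem_enum inE; apply: (iffP forallP) => H y; first exact/eqP/H.
exact/eqP/H.
Qed.

(** By injectivity both orbits can be walked back from [z] in parallel; a head has no preimage, so
    both reach their heads at the same step. *)
Lemma sim_heads_inj f x x' i j z :
  x \in sim_heads f -> x' \in sim_heads f ->
  (f ^+ i)%g x = Some z -> (f ^+ j)%g x' = Some z -> x = x' /\ i = j.
Proof.
move=> /sim_headsP hx /sim_headsP hx'; elim: i j z => [|i IHi] [|j] z.
- by rewrite !sim_exp0 => -[->] [->].
- rewrite sim_exp0 sim_expS => -[<-]; case: (_ x') => //= y /hx; case.
- rewrite sim_exp0 sim_expS => + -[zx]; rewrite -zx.
  case: (_ x) => //= y /hx'; case.
rewrite !sim_expS; case Ex: (_ x) => [y|] //= fy.
case Ey: (_ x') => [y'|] //= fy'.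
have E := sim_fun_inj fy fy'; rewrite -E in Ey.
by have [-> ->] := IHi _ _ Ex Ey.
Qed.

Lemma ltn_sim_len M f x j :
  (f ^+ M)%g x = None -> (j < sim_len M f x) = ((f ^+ j)%g x != None).
Proof.
move=> fM; apply/idP/idP => [jl|].
  have jM : j < M.
    by apply: leq_trans jl _; rewrite -[leqRHS](size_iota 0) find_size.
  by have := before_find 0 jl; rewrite nth_iota // => ->.
apply: contraR; rewrite -leqNgt => lj; apply/eqP/(sim_exp_none lj).
have [h|] := boolP (has (fun j => (f ^+ j)%g x == None) (iota 0 M)).
  have := nth_find 0 h; rewrite nth_iota; first by move/eqP.
  by rewrite has_find size_iota in h.
(* If no exponent below [M] works, [find] returns [M], where the power is undefined by [fM]. *)
by rewrite /sim_len => /hasNfind ->; rewrite size_iota.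
Qed.

Lemma onth_sim_path M f x j :
  (f ^+ M)%g x = None -> onth (sim_path M f x) j = (f ^+ j)%g x.
Proof.
move=> fM; have := ltn_sim_len j fM; case: ltnP => [jl|lj].
  rewrite (onth_some x) ?size_mkseq // nth_mkseq //.
  by case: (_ x).
by rewrite onth_default ?size_mkseq // => /esym/negbT; rewrite negbK => /eqP.
Qed.

Lemma path_rep_nilpotent M f :
  (forall x, (f ^+ M)%g x = None) -> path_rep f (sim_paths M f).
Proof.
move=> fM; have Uh : uniq (sim_heads f) by apply: enum_uniq.
have Uf : uniq (flatten (sim_paths M f)).
  apply: (@allpairs_uniq_dep _ (fun=> nat) _
     (fun x j => odflt x ((f ^+ j)%g x)) _
     (fun x => iota 0 (sim_len M f x))) => //.
    by move=> x _; apply: iota_uniq.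
  move=> _ _ /allpairsPdep[x [i [hx + ->]]] /allpairsPdep[y [j [hy + ->]]] /=.
  rewrite !mem_iota /= !add0n !ltn_sim_len //.
  case Ex: ((f ^+ i)%g x) => [u|] // _.
  case Ey: ((f ^+ j)%g y) => [v|] //= _ uv.
  by rewrite -uv in Ey; have [-> ->] := sim_heads_inj hx hy Ex Ey.
apply/and3P; split.
- rewrite all_map; apply/allP => x _ /=; rewrite -size_eq0 size_mkseq -lt0n.
  by rewrite ltn_sim_len // sim_exp0.
- apply: uniq_perm; rewrite ?enum_uniq // => y; rewrite mem_enum inE.
  (* Going back from [y] as far as possible: nilpotency bounds the number of steps, and the point
     reached at the maximal [j] has no preimage, so it is a head. *)
  pose Q j := [exists x, (f ^+ j)%g x == Some y].
  have exQ : exists j, Q j.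
    by exists 0; apply/existsP; exists y; rewrite sim_exp0.
  have ubQ j : Q j -> j <= M.
    move=> /existsP[x /eqP fx]; rewrite leqNgt; apply/negP => /ltnW Mj.
    by rewrite (sim_exp_none Mj) in fx.
  case: (ex_maxnP exQ ubQ) => j /existsP[x /eqP fx] jmax.
  apply/flattenP; exists (sim_path M f x); last first.
    by apply/onthP; exists j; rewrite onth_sim_path.
  apply/map_f/sim_headsP => z fz.
  have /jmax : Q j.+1; last by rewrite ltnn.
  by apply/existsP; exists z; rewrite expgS sim_mulE fz /= fx.
apply/allP => t pt; have Ut := uniq_flatten_mem Uf pt.
case/mapP: pt Ut => x hx -> Ut; apply/allP => y yt; apply/eqP.
rewrite onth_sim_path // sim_expS -(@onth_sim_path M) //.
by rewrite (onth_some y) ?index_mem // nth_index.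
Qed.

End Nilpotent.

(** * Path lengths of a root as a tuple of partitions *)

Lemma mul_add_inj (k b c x y : nat) :
  0 < x <= k -> 0 < y <= k -> b * k + x = c * k + y -> b = c /\ x = y.
Proof.
move=> /andP[x0 xk] /andP[y0 yk] E.
have bc : b = c by case: (ltngtP b c) => // bc; nia.
by split=> //; move: E; rewrite bc => /addnI.
Qed.

Section Levels.

Variables k m : nat.
Implicit Types (l : seq nat) (lam : {ffun 'I_m -> intpart}) (i : 'I_m).

(** A path of length [base i + a] with [0 < a <= k] has as its [k]-th power [a] paths of length
    [m - i] and, when [m - i.+1] is positive, [k - a] paths of length [m - i.+1]. Here [i] counts
    from 0. *)
Definition base i : nat := (m - i.+1) * k.

Lemma base_inj i i' x y :
  0 < x <= k -> 0 < y <= k -> base i + x = base i' + y -> i = i' /\ x = y.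
Proof.
move=> Hx Hy /(mul_add_inj Hx Hy)[E ->]; split=> //; apply: val_inj => /=.
by have := ltn_ord i; have := ltn_ord i'; lia.
Qed.

Definition join_levels lam : seq nat :=
  [seq base i + a | i <- enum 'I_m, a <- (lam i : seq nat)].

(** Sorting makes the result depend only on the multiset of the entries of [l]. *)
Definition level l i : seq nat :=
  sort geq [seq a - base i | a <- l & base i < a <= base i + k].

Lemma level_spec l i : sorted geq (level l i) && all (leq 1) (level l i).
Proof.
apply/andP; split.
  by apply: sort_sorted => a b; apply: leq_total.
rewrite all_sort all_map; apply/allP => a; rewrite mem_filter /= subn_gt0.
by case/andP=> /andP[].
Qed.

Definition levels l : {ffun 'I_m -> intpart} :=
  [ffun i => MkIntpart (level_spec l i)].

Definition bounded lam := forall i, all (fun a => a <= k) (lam i).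

Lemma bounded_mem lam i a :
  bounded lam -> a \in (lam i : seq nat) -> 0 < a <= k.
Proof.
move=> /(_ i)/allP bl la; rewrite bl // andbT.
by case/andP: (parts_spec (lam i)) => _ /allP; apply.
Qed.

Lemma bounded_levels l : bounded (levels l).
Proof.
move=> i; rewrite ffunE /= all_sort all_map; apply/allP => a.
by rewrite mem_filter /= leq_subLR => /andP[/andP[]].
Qed.

Lemma count_level l i a :
  0 < a <= k -> count_mem a (level l i) = count_mem (base i + a) l.
Proof.
move=> Ha; rewrite /level (seq.permP (permEl (perm_sort _ _))).
rewrite count_map count_filter.
by apply: eq_count => b /=; lia.
Qed.

Lemma count_join lam i a : bounded lam -> 0 < a <= k ->
  count_mem (base i + a) (join_levels lam) = count_mem a (lam i).
Proof.
move=> bl Ha; rewrite count_flatten -map_comp sumnE big_map big_enum /=.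
rewrite (bigD1 i) //= count_map big1 ?addn0 => [|i' i'i].
  by apply: eq_count => b /=; rewrite eqn_add2l.
apply/count_memPn/mapP => -[b lb] /(base_inj Ha (bounded_mem bl lb))[/esym/eqP].
by rewrite (negPf i'i).
Qed.

Lemma mem_join lam c : bounded lam -> c \in join_levels lam -> 0 < c <= k * m.
Proof.
move=> bl /allpairsPdep[i [a [_ /(bounded_mem bl) Ha ->]]].
have : m - i.+1 < m by have := ltn_ord i; lia.
rewrite /base; move: (m - i.+1) => b; nia.
Qed.

Lemma levelsK l : all (fun a => 0 < a <= k * m) l ->
  perm_eq (join_levels (levels l)) l.
Proof.
move=> l_b; apply/allP => c _; apply/eqP => /=.
have [Hc|Hc] := boolP (0 < c <= k * m); last first.
  rewrite !(count_memPn _) //; first by apply: contra Hc => /(allP l_b).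
  by apply: contra Hc => /mem_join; apply; apply: bounded_levels.
have k_gt0 : 0 < k by case: (k) Hc => //; lia.
(* Dividing [c.-1] instead of [c] puts the remainder [a] between 1 and [k]; the level is [m - b.+1]
   because [base] decreases with the index. *)
pose b := c.-1 %/ k; pose a := (c.-1 %% k).+1.
have cE : c = b * k + a by have := divn_eq c.-1 k; rewrite /b /a; lia.
have ak : 0 < a <= k by rewrite /a /= ltn_pmod.
have bm : b < m by rewrite /b ltn_divLR // mulnC; lia.
have im : m - b.+1 < m by lia.
have -> : c = base (Ordinal im) + a.
  by rewrite /base /= cE; congr (_ * _ + _); lia.
rewrite count_join //; last exact: bounded_levels.
by rewrite ffunE count_level.
Qed.

Lemma perm_levels l l' : perm_eq l l' -> levels l = levels l'.
Proof.
move=> P; apply/ffunP => i; rewrite !ffunE; apply: val_inj => /=.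
apply/perm_sortP; [by move=> a b; apply: leq_total
  | by move=> ? ? ? /= ? ?; lia | by move=> a b /= ?; lia |].
exact/perm_map/perm_filter.
Qed.

Lemma join_levelsK lam : bounded lam -> levels (join_levels lam) = lam.
Proof.
move=> bl; apply/ffunP => i; apply: val_inj => /=.
have [geq_tr geq_as] : transitive geq /\ antisymmetric geq.
  by split=> [? ? ? /= ? ?|a b /= ?]; lia.
apply: (sorted_eq geq_tr geq_as).
- by case/andP: (parts_spec (levels (join_levels lam) i)).
- by case/andP: (parts_spec (lam i)).
apply/allP => a _; apply/eqP => /=.
have [Ha|Ha] := boolP (0 < a <= k).
  by rewrite ffunE /= count_level // count_join.
rewrite !(count_memPn _) //; apply: contra Ha; first exact: bounded_mem.
by apply: bounded_mem; apply: bounded_levels.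
Qed.

(** Raising the threshold from [k * j] to [k * j.+1] takes from the length [base i + a] the amount
    0, [a] or [k], according as [m - i.+1] is less than, equal to or greater than [j]. *)
Lemma excess_join lam j : bounded lam ->
  excess (join_levels lam) (k * j) =
    excess (join_levels lam) (k * j.+1) +
    (\sum_(i < m | m - i.+1 == j) sumn (lam i)
     + k * \sum_(i < m | j < m - i.+1) size (lam i)).
Proof.
move=> bl; rewrite /excess !big_allpairs_dep !big_enum /=.
rewrite big_distrr /= [X in _ + (X + _)]big_mkcond [X in _ + (_ + X)]big_mkcond.
rewrite -!big_split /=; apply: eq_bigr => i _.
have -> : (if m - i.+1 == j then sumn (lam i) else 0) =
          \sum_(a <- lam i) (m - i.+1 == j) * a.
  by rewrite sumnE -big_distrr /=; case: eqP; rewrite ?mul1n ?mul0n.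
have -> : (if j < m - i.+1 then k * size (lam i) else 0) =
          \sum_(a <- lam i) (j < m - i.+1) * k.
  by rewrite big_const_seq count_predT iter_addn_0; case: ltnP => _;
     rewrite ?mul1n ?mul0n.
rewrite -!big_split /= big_seq [RHS]big_seq.
apply: eq_bigr => a /(bounded_mem bl).
rewrite /base; move: (m - i.+1) => b; case: (ltngtP b j) => bj Ha.
- have : b * k + k <= k * j by nia.
  nia.
- have : k * j + k <= b * k by nia.
  nia.
- rewrite bj; nia.
Qed.

Lemma mult_fact_join lam : bounded lam ->
  mult_fact (join_levels lam) =
  \prod_(i < m) \prod_(a <- undup (lam i)) (count_mem a (lam i))`!.
Proof.
move=> bl.
rewrite (@mult_fact_prod [seq base i + a | i <- enum 'I_m, a <- undup (lam i)]).
- rewrite big_allpairs_dep big_enum /=; apply: eq_bigr => i _.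
  rewrite big_seq [RHS]big_seq; apply: eq_bigr => a.
  by rewrite mem_undup => /(bounded_mem bl) Ha; rewrite count_join.
- apply: allpairs_uniq_dep => [|i _|]; [exact: enum_uniq | exact: undup_uniq |].
  move=> _ _ /allpairsPdep[i [a [_ + ->]]] /allpairsPdep[i' [a' [_ + ->]]] /=.
  rewrite !mem_undup => /(bounded_mem bl) Ha /(bounded_mem bl) Ha'.
  by move=> /(base_inj Ha Ha')[-> ->].
- move=> _ /allpairsPdep[i [a [hi la ->]]]; apply/allpairsPdep.
  by exists i, a; rewrite mem_undup.
Qed.

Variable n : 'I_m -> nat.

Definition path_lengths : seq nat :=
  flatten [seq nseq (n i) (m - i) | i <- enum 'I_m].

Lemma excess_path_lengths j :
  excess path_lengths j =
    excess path_lengths j.+1 + \sum_(i < m | j < m - i) n i.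
Proof.
rewrite excessS count_flatten -map_comp sumnE big_map big_enum /=.
congr (_ + _).
rewrite [RHS]big_mkcond; apply: eq_bigr => i _ /=; rewrite count_nseq.
by case: ltnP => _; rewrite ?mul1n ?mul0n.
Qed.

Lemma mult_fact_path_lengths : mult_fact path_lengths = \prod_(i < m) (n i)`!.
Proof.
have inj : injective (fun i : 'I_m => m - i).
  by move=> i i' /= E; apply: val_inj => /=;
     have := ltn_ord i; have := ltn_ord i'; lia.
rewrite (@mult_fact_prod [seq m - i | i : 'I_m <- enum 'I_m]).
- rewrite big_map big_enum /=; apply: eq_bigr => i _; congr (_ `!).
  rewrite count_flatten -map_comp sumnE big_map big_enum /= (bigD1 i) //=.
  rewrite count_nseq /= eqxx mul1n big1 ?addn0 // => i' i'i.
  by rewrite count_nseq /= (inj_eq inj) (negPf i'i).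
- by rewrite map_inj_uniq ?enum_uniq.
- move=> a /flattenP[_ /mapP[i hi ->]]; rewrite mem_nseq => /andP[_ /eqP ->].
  exact: map_f.
Qed.

(** The equation in [admissible] with its negative term moved to the other side, so that it can be
    stated in [nat]. *)
Definition balanced lam := forall i,
  sumn (lam i) + k * \sum_(i' < m | i' < i) size (lam i') =
  \sum_(i' < m | i' <= i) n i'.

(** Both sequences vanish from [j = m] on, so they agree if and only if their successive differences
    do; the difference at [m - i.+1] is the balance equation at [i]. *)
Lemma balancedP lam : bounded lam ->
  (forall j, excess (join_levels lam) (k * j) = excess path_lengths j) <->
  balanced lam.
Proof.
move=> bl; pose D j := \sum_(i < m | m - i.+1 == j) sumn (lam i)
     + k * \sum_(i < m | j < m - i.+1) size (lam i).
have DE i : D (m - i.+1) =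
    sumn (lam i) + k * \sum_(i' < m | i' < i) size (lam i').
  congr (_ + k * _); last first.
    by apply: eq_bigl => i'; have := ltn_ord i; have := ltn_ord i'; lia.
  rewrite (big_pred1 i) // => i'; apply/eqP/eqP => [E|-> //].
  by apply: val_inj => /=; have := ltn_ord i; have := ltn_ord i'; lia.
have NE i : \sum_(i' < m | m - i.+1 < m - i') n i' =
    \sum_(i' < m | i' <= i) n i'.
  by apply: eq_bigl => i'; have := ltn_ord i; have := ltn_ord i'; lia.
split=> [E i|bal j].
  rewrite -DE -NE; apply/eqP.
  rewrite -(eqn_add2l (excess path_lengths (m - i.+1).+1)) -excess_path_lengths.
  by rewrite -!E -excess_join.
(* Downward induction on [j], starting from the range [m <= j], where both sides are 0. *)
have [d] := ubnP (m - j); elim: d j => // d IHd j jd.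
have [mj|jm] := leqP m j.
  transitivity 0; last apply/esym; apply/eqP; rewrite excess_eq0;
    apply/allP => a.
    by move=> /(mem_join bl); nia.
  by move=> /flattenP[_ /mapP[i _ ->]];
     rewrite mem_nseq => /andP[_ /eqP ->]; lia.
rewrite excess_join // excess_path_lengths IHd; last by lia.
have im : m - j.+1 < m by lia.
have jE : j = m - (Ordinal im).+1 by rewrite /=; lia.
by congr (_ + _); rewrite -/(D j) jE DE NE.
Qed.

End Levels.

(** * Counting the roots *)

(** Subtracting the balance equation at [i] from the one at [i' = i.+1] leaves [sumn (lam i') + k *
    size (lam i) = n i' + sumn (lam i)], which gives the bound on [size (lam i)]. *)
Lemma admissibleP (k m : nat) (n : 'I_m -> nat) (lam : {ffun 'I_m -> intpart}) :
  0 < k -> admissible k n lam <-> bounded k lam /\ balanced k n lam.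
Proof.
move=> k_gt0.
have bE : (forall i : 'I_m, \max_(a <- lam i) a <= k) <-> bounded k lam.
  split=> H i; last by apply/bigmax_leqP_seq => a la _; apply: (allP (H i)).
  by apply/allP => a la; move/bigmax_leqP_seq: (H i); apply.
split=> [[E /bE bl _]|[/bE bl E]].
  by split=> // i; have := E i; lia.
split=> // [j|i i' ii']; first by have := E j; lia.
rewrite ler_pdivlMr ?ltr0n // -natrM ler_nat.
have := E i'; rewrite (bigD1 i' (leqnn i')) /= (bigD1 i) /=;
  last by rewrite ii' ltnSn.
have := E i.
rewrite [X in _ + k * X = _ -> _](eq_bigl
  (fun j : 'I_m => (j < i') && (j != i))); last first.
  by move=> j; rewrite -val_eqE /= ii' ltnS [LHS]ltn_neqAle andbC.
rewrite [X in _ = X -> _ -> _](eq_bigl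
  (fun j : 'I_m => (j <= i') && (j != i'))).
  rewrite mulnDr; set A := (\sum_(_ < _ | _ && _) size _);
    set B := (\sum_(_ < _ | _ && _) n _).
  move: A B => A B; rewrite (mulnC (size _)); lia.
by move=> j; rewrite -val_eqE /= ii' -ltnS [LHS]ltn_neqAle andbC.
Qed.

Section Roots.

Variables (X : finType) (k m : nat) (n : 'I_m -> nat) (sigma : SIM X).
Variable ss : seq (seq X).
Hypotheses (sigma_ss : path_rep sigma ss)
  (size_ss : map size ss = path_lengths n).

Local Notation sizes f := (map size (sim_paths (k * m) f)).
Local Notation type_of f := (levels k m (sizes f)).

Lemma rep_sizes_gt0 (f : SIM X) ss' :
  path_rep f ss' -> all (leq 1) (map size ss').
Proof.
by case/and3P=> n0 _ _; rewrite all_map; apply: sub_all n0; case.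
Qed.

Lemma domain_eq0 (f : SIM X) j :
  #|[pred x | (f ^+ j)%g x != None]| = 0 -> forall x, (f ^+ j)%g x = None.
Proof. by move=> /card0_eq f0 x; have := f0 x; rewrite inE => /eqP. Qed.

Lemma excess_path_lengths0 : excess (path_lengths n) m = 0.
Proof.
apply/eqP; rewrite excess_eq0; apply/allP => a /flattenP[_ /mapP[i _ ->]].
by rewrite mem_nseq => /andP[_ /eqP ->]; apply: leq_subr.
Qed.

Lemma domain_sigma j :
  #|[pred x | (sigma ^+ j)%g x != None]| = excess (path_lengths n) j.
Proof. by rewrite (rep_domain sigma_ss) size_ss. Qed.

Section Root.

Variable alpha : SIM X.
Hypothesis alpha_root : (alpha ^+ k)%g = sigma.

(** A root is nilpotent: its power [k * m] is [sigma ^+ m], which is nowhere defined because the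
    paths of [sigma] have length at most [m]. *)
Lemma root_rep : path_rep alpha (sim_paths (k * m) alpha).
Proof.
apply/path_rep_nilpotent/domain_eq0.
by rewrite expgnA alpha_root domain_sigma excess_path_lengths0.
Qed.

Lemma root_excess j : excess (sizes alpha) (k * j) = excess (path_lengths n) j.
Proof. by rewrite -(rep_domain root_rep) expgnA alpha_root domain_sigma. Qed.

Lemma root_join : perm_eq (join_levels k (type_of alpha)) (sizes alpha).
Proof.
apply: levelsK; apply/allP => a la; rewrite (allP (rep_sizes_gt0 root_rep)) //=.
by move: a la; apply/allP; rewrite -excess_eq0 root_excess excess_path_lengths0.
Qed.

Lemma root_bounded : bounded k (type_of alpha).
Proof. exact: bounded_levels. Qed.

Lemma root_balanced : balanced k n (type_of alpha).
Proof.
apply/balancedP => [|j]; first exact: root_bounded.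
by rewrite (perm_excess root_join) root_excess.
Qed.

End Root.

Lemma card_roots_of_type (lam : {ffun 'I_m -> intpart}) :
  bounded k lam -> balanced k n lam ->
  #|[pred alpha : SIM X | ((alpha ^+ k)%g == sigma) && (type_of alpha == lam)]|
    * mult_fact (join_levels k lam) = mult_fact (path_lengths n).
Proof.
move=> bl /(balancedP _ bl) E; set l := join_levels k lam in E *.
have l_gt0 : all (leq 1) l by apply/allP => a /(mem_join bl)/andP[].
(* The case [j = 0] of [E]: the domain of [sigma ^+ 0] is all of [X]. An enumeration of [X] can
   therefore be cut into paths of lengths [l]. *)
have sz_l : sumn l = #|X|.
  rewrite sumn_excess -(muln0 k) E -domain_sigma; apply: eq_card => x.
  by rewrite !inE sim_exp0.
have [f rf] : exists f, path_rep f (reshape l (enum X)).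
  apply: path_rep_exists; last by rewrite reshapeKr // sz_l -cardE.
  have : all (leq 1) (shape (reshape l (enum X))).
    by rewrite reshapeKl // sz_l -cardE.
  by rewrite all_map; apply: sub_all; case.
have szf : map size (reshape l (enum X)) = l.
  by rewrite -/(shape _) reshapeKl // sz_l -cardE.
have domfk j : #|[pred x | ((f ^+ k) ^+ j)%g x != None]| =
    excess (path_lengths n) j.
  by rewrite -expgnA (rep_domain rf) szf E.
have rfk : path_rep (f ^+ k)%g (sim_paths m (f ^+ k)%g).
  by apply/path_rep_nilpotent/domain_eq0; rewrite domfk excess_path_lengths0.
have Pfk : perm_eq (map size (sim_paths m (f ^+ k)%g)) (path_lengths n).
  apply: excess_inj; rewrite ?(rep_sizes_gt0 rfk) //.
    by rewrite -size_ss (rep_sizes_gt0 sigma_ss).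
  by move=> j; rewrite -(rep_domain rfk).
rewrite -(perm_mult_fact Pfk) -(card_sim_conj rfk sigma_ss) ?size_ss //.
rewrite -!sum1_card.
(* The permutations conjugating [f ^+ k] to [sigma] are sorted by the root [sim_conj s f] that they
   produce. *)
rewrite [RHS](partition_big (fun s => sim_conj s f)
   (fun alpha => (alpha ^+ k)%g == sigma)) /=; last first.
  by move=> s; rewrite inE sim_conjX.
rewrite big_distrl /= [LHS]big_mkcondr; apply: eq_bigr => alpha /eqP rt.
rewrite (eq_bigl (mem [pred s | sim_conj s f == alpha])); last first.
  move=> s; rewrite !inE andb_idl // => /eqP fa.
  by rewrite sim_conjX fa rt.
rewrite sum1_card.
have ra := root_rep rt.
(* The fibre over a root of type [lam] has [mult_fact l] elements; over a root of another type it is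
   empty, as conjugation preserves path lengths. *)
have [tp|tp] := eqVneq.
  by rewrite mul1n (card_sim_conj rf ra) szf // /l -tp root_join.
apply/esym/eqP; rewrite -leqn0 leqNgt; apply/negP => /card_gt0P[s].
rewrite inE => /eqP/(sim_conj_type rf ra); rewrite szf => P.
by case/eqP: tp; rewrite -(perm_levels _ _ P) join_levelsK.
Qed.

End Roots.

Local Open Scope ring_scope.

Theorem theorem4 (X : finType) (k m : nat) (n : 'I_m -> nat) (sigma : SIM X)
    (p : forall i : 'I_m, 'I_(n i) -> seq X) :
  (0 < k)%N ->
  (2 <= m)%N ->
  (forall i : 'I_m, (0 < n i)%N) ->
  (forall (i : 'I_m) (j : 'I_(n i)), size (p i j) = (m - i)%N) ->
  is_decomposition sigma
    [seq Path (p i j) | i <- enum 'I_m, j <- enum 'I_(n i)] ->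
  (num_roots k sigma)%:R =
    \sum_(lam \in [set l | admissible k n l]%classic) weight n lam :> rat.
Proof.
move=> k_gt0 _ _ size_p.
pose ss := [seq p i j | i <- enum 'I_m, j <- enum 'I_(n i)].
have -> : [seq Path (p i j) | i <- enum 'I_m, j <- enum 'I_(n i)] = map Path ss.
  by rewrite map_allpairs.
move=> /path_repP rs.
have sz : map size ss = path_lengths n.
  rewrite map_allpairs /path_lengths; congr flatten; apply: eq_map => i.
  rewrite (eq_map (size_p i)) -[RHS](map_id) -[n i in RHS]size_enum_ord.
  by elim: (enum _) => //= a s ->.
pose type_of (alpha : SIM X) := levels k m (map size (sim_paths (k * m) alpha)).
pose roots := [pred alpha : SIM X | (alpha ^+ k)%g == sigma].
pose r := undup (map type_of (enum roots)).
(* The admissible tuples are exactly the types of the roots, hence finitely many: by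
   [card_roots_of_type] the number of roots of an admissible type is a factor of a positive
   number. *)
have -> : [set l | admissible k n l]%classic = [set` r]%classic.
  apply/seteqP; split=> lam /=; rewrite mem_undup.
    move=> /(admissibleP _ _ k_gt0)[bl /(card_roots_of_type rs sz bl) E].
    have /card_gt0P[alpha /andP[rt /eqP tp]] :
        (0 < #|[pred alpha | ((alpha ^+ k)%g == sigma)
                              && (type_of alpha == lam)]|)%N.
      by rewrite lt0n; apply/eqP => E0; have := mult_fact_gt0 (path_lengths n);
         rewrite -E E0.
    by rewrite -tp map_f // mem_enum.
  case/mapP => alpha; rewrite mem_enum => /eqP rt ->.
  apply/(admissibleP _ _ k_gt0).
  by split; [exact: root_bounded | exact: (root_balanced rs sz rt)].
rewrite -fsbig_seq ?undup_uniq //.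
(* Each weight is the number of roots of type [lam]. *)
rewrite (eq_big_seq (fun lam =>
  (\sum_(alpha in roots) (lam == type_of alpha))%N%:R)); last first.
  move=> lam; rewrite mem_undup => /mapP[alpha]; rewrite mem_enum => /eqP rt ->.
  have bl : bounded k (type_of alpha) by exact: root_bounded.
  have /(card_roots_of_type rs sz bl) E := root_balanced rs sz rt.
  rewrite /weight -mult_fact_path_lengths.
  rewrite -[X in _ / X%:R]/(\prod_i
     \prod_(a <- _) (count_mem a (type_of alpha i))`!)%N.
  rewrite -(mult_fact_join bl) -E natrM mulfK; last first.
    by rewrite pnatr_eq0 -lt0n mult_fact_gt0.
  congr (_%:R); rewrite -sum1_card big_mkcondr /=.
  by apply: eq_bigr => beta _; rewrite eq_sym; case: eqP.
(* After exchanging the sums, each root is counted once, since its type occurs exactly once in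
   [r]. *)
rewrite -natr_sum exchange_big /= /num_roots -sum1_card; congr (_%:R).
apply: eq_bigr => alpha rt.
rewrite -[LHS](_ : count_mem (type_of alpha) r = 1%N); last first.
  by rewrite count_uniq_mem ?undup_uniq // mem_undup map_f ?mem_enum.
rewrite -sum1_count big_mkcond /=; apply: eq_bigr => lam _.
by case: eqP.
Qed.
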